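(* Let $(X,\|\cdot\|_\infty)$ and $\sigma\colon X\times X\times[0,1]\to X$ be the metric space and the bicombing defined in the context. Then the map $\tau\colon X\times X\times[0,1]\to X$ defined by $$\tau(p,q,t):=\begin{cases}\sigma\big(p,\tfrac12\big(\sigma(p,q,\tfrac12)+\sigma(q,p,\tfrac12)\big),2t\big),&\text{if }t\in[0,\tfrac12],\\ \sigma\big(\tfrac12\big(\sigma(p,q,\tfrac12)+\sigma(q,p,\tfrac12)\big),q,2t-1\big),&\text{if }t\in[\tfrac12,1],\end{cases}$$ is a non-reversible conical bicombing on $(X,\|\cdot\|_\infty)$ that has the midpoint property.
   Context: General definitions. Let $(X,d)$ be a metric space. A (geodesic) bicombing on $X$ is a map $\sigma\colon X\times X\times[0,1]\to X$ such that, writing $\sigma_{pq}(t):=\sigma(p,q,t)$, for all $p,q\in X$ one has $\sigma_{pq}(0)=p$, $\sigma_{pq}(1)=q$, and $d(\sigma_{pq}(t),\sigma_{pq}(s))=|t-s|\cdot d(p,q)$ for all $s,t\in[0,1]$. It is conical if $d(\sigma_{pq}(t),\sigma_{p'q'}(t))\le(1-t)\,d(p,p')+t\,d(q,q')$ for all $p,q,p',q'\in X$ and $t\in[0,1]$; reversible if $\sigma_{pq}(t)=\sigma_{qp}(1-t)$ for all $p,q\in X$, $t\in[0,1]$ (non-reversible otherwise); it has the midpoint property if $\sigma_{pq}(\tfrac12)=\sigma_{qp}(\tfrac12)$ for all $p,q\in X$. The space and $\sigma$. Equip $\mathbb{R}^2$ with the maximum norm $\|\cdot\|_\infty$. Let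 $s(x,y):=(x,-y)$ and $$X:=\{(x,y)\in\mathbb{R}^2:x\in[-2,1],\ |x|-1\le y\le||x|-1|\},\qquad A:=\{(x,y)\in\mathbb{R}^2:|x+1|\le y\le1\},$$ $X':=s(X)$, $A':=s(A)$, $Y:=X\cup A$, $Y':=X'\cup A'$. Let $f\colon X'\to X$ be the bijective isometry $f(x,y)=(x,y)$ if $x\in[-1,1]$ and $f(x,y)=s(x,y)$ if $x\in[-2,-1]$. Let $\pi\colon Y\cup Y'\to X\cup X'$ be given by $\pi(x,y):=(x,\operatorname{sgn}(y)\min\{|y|,||x|-1|\})$; it maps $Y$ to $X$ and $Y'$ to $X'$. Let $\lambda(p,q,t):=(1-t)p+tq$ on $\mathbb{R}^2$. Writing $p_x,q_x$ for the first coordinates of $p,q$, define $\sigma\colon X\times X\times[0,1]\to X$ by $$\sigma(p,q,t):=\begin{cases}\pi(\lambda(p,q,t)),&\text{if }p_x\le q_x,\\ f(\pi(\lambda(f^{-1}(p),f^{-1}(q),t))),&\text{if }q_x\le p_x.\end{cases}$$ *)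

(* Defs.v *)
From HB Require Import structures.
From mathcomp Require Export all_boot all_order all_algebra.
From mathcomp Require Export all_classical all_reals all_analysis.
From mathcomp Require Import ring lra.
Export numFieldNormedType.Exports.
Set Implicit Arguments.
Unset Strict Implicit.
Unset Printing Implicit Defensive.
Import Order.TTheory GRing.Theory Num.Theory.
Local Open Scope classical_set_scope.
Local Open Scope ring_scope.

(* The metric space is a subset X of an ambient metric space M, with the
   restricted metric.  A map X * X * [0, 1] -> X is represented by a total
   function of which only the values on X * X * [0, 1] matter; that these lie
   in X is the first clause of [bicombing]. *)
Section Bicombings.
Context {R : realType} {M : metricType R}.
Implicit Types (X : set M) (sigma : M -> M -> R -> M).

Definition bicombing X sigma : Prop :=
  [/\ forall p q t, X p -> X q -> t \in `[0, 1] -> X (sigma p q t),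
      forall p q, X p -> X q -> sigma p q 0 = p,
      forall p q, X p -> X q -> sigma p q 1 = q &
      forall p q s t, X p -> X q -> s \in `[0, 1] -> t \in `[0, 1] ->
        mdist (sigma p q t) (sigma p q s) = `|t - s| * mdist p q].

Definition conical X sigma : Prop :=
  forall p q p' q' t, X p -> X q -> X p' -> X q' -> t \in `[0, 1] ->
    mdist (sigma p q t) (sigma p' q' t)
      <= (1 - t) * mdist p p' + t * mdist q q'.

Definition reversible X sigma : Prop :=
  forall p q t, X p -> X q -> t \in `[0, 1] ->
    sigma p q t = sigma q p (1 - t).

Definition midpoint_property X sigma : Prop :=
  forall p q, X p -> X q -> sigma p q (1 / 2) = sigma q p (1 / 2).

End Bicombings.

Section Space.
Context {R : realType}.
Implicit Types (p q : R * R) (t : R).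

Let dist p q : R := `|p - q|.

Let dist_eq0 p q : dist p q = 0 -> p = q.
Proof. by move=> /normr0_eq0 /subr0_eq. Qed.

Let ball_dist p (e : R) : ball p e = [set q | dist p q < e].
Proof. by rewrite -ball_normE. Qed.

(* R * R with the distance of its library norm, i.e. the maximum norm *)
HB.instance Definition _ := PseudoMetric_isMetric.Build R (R * R)%type
  (fun p q => normr_ge0 (p - q)) dist_eq0 ball_dist.

Lemma mdist_max p q :
  mdist p q = Num.max `|p.1 - q.1| `|p.2 - q.2|.
Proof. by []. Qed.

Definition s p : R * R := (p.1, - p.2).

Definition X : set (R * R) :=
  [set p | p.1 \in `[-2, 1] /\ `|p.1| - 1 <= p.2 <= `| `|p.1| - 1 |].

Definition A : set (R * R) := [set p | `|p.1 + 1| <= p.2 <= 1].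

Definition X' : set (R * R) := s @` X.
Definition A' : set (R * R) := s @` A.
Definition Y : set (R * R) := X `|` A.
Definition Y' : set (R * R) := X' `|` A'.

Definition f p : R * R := if p.1 \in `[-1, 1] then p else s p.

Definition f_inv : R * R -> R * R := pinv X' f.

Definition pi p : R * R :=
  (p.1, Num.sg p.2 * Num.min `|p.2| `| `|p.1| - 1 |).

Definition lambda p q t : R * R := (1 - t) *: p + t *: q.

Definition sigma p q t : R * R :=
  if p.1 <= q.1 then pi (lambda p q t)
  else f (pi (lambda (f_inv p) (f_inv q) t)).

Definition mid p q : R * R :=
  (1 / 2) *: (sigma p q (1 / 2) + sigma q p (1 / 2)).

Definition tau p q t : R * R :=
  if t <= 1 / 2 then sigma p (mid p q) (2 * t)
  else sigma (mid p q) q (2 * t - 1).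

(* The maps above are well defined: f is a bijection from X' to X, pi maps Y
   to X and Y' to X', sigma takes X * X * [0, 1] to X, mid takes X * X to X,
   and the two cases of sigma and of tau agree where they overlap. *)

Lemma XE x y : X (x, y) <->
  [/\ -2 <= x <= 1, - x - 1 <= y, x - 1 <= y &
      if -1 <= x then y <= 1 + x /\ y <= 1 - x else y = - x - 1].
Proof.
rewrite /X /= in_itv /=.
have [x0|x0] := ler0P x; have [x1|x1] := lerP (-1) x.
- rewrite ler0_norm; last lra.
  by split=> [[-> /andP[? ?]]|[-> ? ? [? ?]]]; split => //; lra.
- rewrite ger0_norm; last lra.
  by split=> [[-> /andP[? ?]]|[-> ? ? ?]]; split => //; lra.
- split=> [[/andP[-> h]]|[/andP[-> h]]]; (rewrite ler0_norm; last lra).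
    by move=> /andP[? ?]; rewrite h; split => //; lra.
  by move=> ? ? [? ?]; rewrite h; split => //; lra.
- lra.
Qed.

Lemma X'E x y : X' (x, y) <-> X (x, - y).
Proof.
split=> [[[x' y'] /= Xp [<- <-]]|Xp]; first by rewrite opprK.
by exists (x, - y) => //; rewrite /s /= opprK.
Qed.

Lemma fE x y : -2 <= x <= 1 -> f (x, y) = if -1 <= x then (x, y) else (x, - y).
Proof. by move=> /andP[_ x1]; rewrite /f in_itv /= x1 andbT. Qed.

Lemma fK : involutive (@f).
Proof.
move=> [x y]; rewrite /f /s /=.
by case h : (x \in `[-1, 1]); rewrite /= h // opprK.
Qed.

Lemma f_XX' p : X' p -> X (f p).
Proof.
case: p => x y /X'E /XE [x21 y1 y2 y3]; rewrite fE //.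
move: y3; case: ifPn => x1 y3; apply/XE; split => //;
  rewrite ?x1 ?(negbTE x1) //; lra.
Qed.

Lemma f_X'X p : X p -> X' (f p).
Proof.
case: p => x y /XE [x21 y1 y2 y3]; rewrite fE //.
move: y3; case: ifPn => x1 y3; apply/X'E/XE; rewrite ?opprK; split => //;
  rewrite ?x1 ?(negbTE x1) //; lra.
Qed.

Lemma f_bij : set_bij X' X (@f).
Proof.
split; first exact: f_XX'.
- by move=> p q _ _; exact: (can_inj fK).
- by move=> p Xp; exists (f p); [exact: f_X'X|exact: fK].
Qed.

Lemma f_invE p : X p -> f_inv p = f p.
Proof.
move=> Xp; rewrite -{1}(fK p) /f_inv pinvKV ?inE //; last exact: f_X'X.
by move=> ? ? _ _; exact: (can_inj fK).
Qed.

Lemma YE x y : Y (x, y) <->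
  [/\ -2 <= x <= 1, - x - 1 <= y, x - 1 <= y, y <= 1 & y <= 1 - x].
Proof.
split=> [[/XE[x21 y1 y2]|]|[x21 y1 y2 y3 y4]].
- by case: ifPn => [x1 [? ?]|x1 ?]; split; lra.
- by rewrite /A /= ler_norml -andbA => /and3P[? ? ?]; split; lra.
have [?|?] := lerP (x + 1) y; first by right; rewrite /A /= ler_norml; lra.
by left; apply/XE; split => //; case: ifPn => ?; lra.
Qed.

Lemma pi_YX p : Y p -> X (pi p).
Proof.
case: p => x y /YE[x21 y1 y2 _ _]; apply/XE; rewrite /pi /=.
have [x1|x1] := lerP (-1) x; last first.
  rewrite (@ler0_norm _ x); last lra.
  rewrite (@ger0_norm _ (- x - 1)); last lra.
  rewrite (@gtr0_norm _ y) ?gtr0_sg; try lra.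
  by rewrite mul1r min_r //; split => //; lra.
have z1 : `| `|x| - 1 | = 1 - `|x|.
  by rewrite distrC ger0_norm // subr_ge0 ler_norml; lra.
rewrite z1 {z1}; case: (ler0P x) => x0; case: (ltrgt0P y) => [y0|y0|->];
  rewrite ?sgr0 ?mul0r ?(gtr0_sg y0) ?(ltr0_sg y0) ?mul1r ?mulN1r;
  try match goal with |- context [Num.min ?a ?b] => case: (leP a b) => ? end;
  split => //; lra.
Qed.

Lemma Y'E p : Y' p -> Y (s p).
Proof.
case=> [[q Xq <-]|[q Aq <-]]; rewrite /s /= opprK -surjective_pairing;
by [left|right].
Qed.

Lemma pi_s p : pi (s p) = s (pi p).
Proof. by rewrite /pi /s /= sgrN normrN mulNr. Qed.

Lemma pi_Y'X' p : Y' p -> X' (pi p).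
Proof.
move=> /Y'E/pi_YX; rewrite pi_s => Xp; exists (s (pi p)) => //.
by rewrite /s /= opprK.
Qed.

Lemma lambda_Y p q t : Y p -> Y q -> t \in `[0, 1] -> Y (lambda p q t).
Proof.
case: p q => x y [x' y'] /YE[/andP[? ?] ? ? ? ?] /YE[/andP[? ?] ? ? ? ?].
rewrite in_itv /= => /andP[t0 t1]; apply/YE; rewrite /= /GRing.scale /=.
by split; nra.
Qed.

Lemma lambda_Y' p q t : Y' p -> Y' q -> t \in `[0, 1] -> Y' (lambda p q t).
Proof.
move=> /Y'E Yp /Y'E Yq t01; have := lambda_Y Yp Yq t01.
have -> : lambda (s p) (s q) t = s (lambda p q t).
  by congr pair; rewrite /= /GRing.scale /=; lra.
move=> [Xl|Al]; [left|right]; exists (s (lambda p q t)) => //;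
  by rewrite {1}/s /= opprK.
Qed.

Lemma sigma_X p q t : X p -> X q -> t \in `[0, 1] -> X (sigma p q t).
Proof.
move=> Xp Xq t01; rewrite /sigma; case: ifP => _.
  by apply/pi_YX/lambda_Y => //; left.
rewrite !f_invE //; apply/f_XX'/pi_Y'X'/lambda_Y' => //; left; exact: f_X'X.
Qed.

Lemma pi_id p : X p -> pi p = p.
Proof.
case: p => x y; rewrite /X /pi /= in_itv /= => -[x21 /andP[y1 y2]].
rewrite min_l -?numEsg //.
have [?|?] := lerP `|x| 1; last first.
  by move: y2; rewrite ler_norml gtr0_norm ?subr_gt0 //; lra.
by move: y2; rewrite distrC ler_norml ger0_norm ?subr_ge0 //; lra.
Qed.

Lemma pi_id' p : X' p -> pi p = p.
Proof. by case=> q Xq <-; rewrite pi_s pi_id. Qed.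

Lemma lambda0 p q : lambda p q 0 = p.
Proof. by rewrite /lambda subr0 scale0r scale1r addr0. Qed.

Lemma lambda1 p q : lambda p q 1 = q.
Proof. by rewrite /lambda subrr scale0r scale1r add0r. Qed.

Lemma sigma0 p q : X p -> X q -> sigma p q 0 = p.
Proof.
move=> Xp Xq; rewrite /sigma !lambda0 pi_id //.
by rewrite f_invE // pi_id' ?fK ?if_same //; exact: f_X'X.
Qed.

Lemma sigma1 p q : X p -> X q -> sigma p q 1 = q.
Proof.
move=> Xp Xq; rewrite /sigma !lambda1 pi_id //.
by rewrite f_invE // pi_id' ?fK ?if_same //; exact: f_X'X.
Qed.

Lemma f1 p : (f p).1 = p.1.
Proof. by rewrite /f; case: ifP. Qed.

Lemma sigma_overlap p q t : X p -> X q -> q.1 <= p.1 ->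
  sigma p q t = f (pi (lambda (f_inv p) (f_inv q) t)).
Proof.
move=> Xp Xq; rewrite le_eqVlt /sigma => /predU1P[qp|];
  last by rewrite ltNge => /negbTE->.
rewrite qp lexx !f_invE //.
case: p q qp Xp Xq => x y [_ y'] /= -> Xp Xq.
have [x21 _ _ hy] := (XE _ _).1 Xp; have [_ _ _ hy'] := (XE _ _).1 Xq.
have [x1|x1] := lerP (-1) x.
  have -> : f (x, y) = (x, y) by rewrite fE // x1.
  have -> : f (x, y') = (x, y') by rewrite fE // x1.
  have -> : lambda (x, y) (x, y') t = (x, (1 - t) * y + t * y').
    by congr pair; rewrite /= /GRing.scale /=; lra.
  by rewrite [RHS]/f /= in_itv /= x1; case/andP: x21 => _ ->.
move: hy hy' Xp Xq; rewrite leNgt x1 /= => -> -> Xp _.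
have lpp z : lambda z z t = z by rewrite /lambda -scalerDl subrK scale1r.
by rewrite !lpp pi_id // pi_id' ?fK //; exact: f_X'X.
Qed.

Lemma sigma_fst p q t : X p -> X q -> (sigma p q t).1 = (1 - t) * p.1 + t * q.1.
Proof.
by move=> Xp Xq; rewrite /sigma !f_invE //; case: ifP; rewrite ?f1 /= ?f1.
Qed.

Lemma mid_X p q : X p -> X q -> X (mid p q).
Proof.
move=> Xp Xq; have h01 : 1 / 2 \in `[0, 1 : R] by rewrite in_itv /=; lra.
have := sigma_X Xp Xq h01; have := sigma_X Xq Xp h01.
have : (sigma p q (1 / 2)).1 = (sigma q p (1 / 2)).1
  by rewrite !sigma_fst //; lra.
rewrite /mid; case: (sigma p q _) (sigma q p _) => [x y] [_ y'] /= <-.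
move=> /XE[x21 ? ? hy] /XE[_ ? ? hy'].
have -> : (1 / 2) *: ((x, y) + (x, y')) = (x, (y + y') / 2).
  by congr pair; rewrite /= /GRing.scale /=; lra.
by apply/XE; move: hy hy'; case: ifP => _ hy hy'; split => //; lra.
Qed.

Lemma tau_overlap p q : X p -> X q ->
  sigma p (mid p q) (2 * (1 / 2)) = sigma (mid p q) q (2 * (1 / 2) - 1).
Proof.
move=> Xp Xq; rewrite mul1r divff ?pnatr_eq0 // subrr.
by rewrite sigma1 ?sigma0 //; exact: mid_X.
Qed.

End Space.

(* Main.v *)
Require Import Defs.
From mathcomp Require Import ring lra.
Set Implicit Arguments.
Unset Strict Implicit.
Unset Printing Implicit Defensive.
Import Order.TTheory GRing.Theory Num.Theory.
Local Open Scope ring_scope.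

(** The set [X] is the diamond [|x| + |y| <= 1] with an antenna attached at
    [(-1, 0)], going up to [(-2, 1)]; in [X'] the antenna goes down instead.
    The vertical projection [pi] clamps [y] to [[- h, h]] with
    [h = ||x| - 1|]; as [h] is a 1-Lipschitz function of [x], [pi] is
    1-Lipschitz for the maximum norm ([pi_lip]).  Flipping the antenna does not
    change distances either ([f_isom]).  So each branch of [sigma] is a linear
    segment followed by 1-Lipschitz maps, read in one of two isometric copies
    of [X], and it inherits the conical inequality and the unit speed of the
    linear segments.  For two pairs with opposite horizontal orders, the
    conical inequality follows by passing through a pair of points with equal
    first coordinates, where both branches agree ([sigma_conical_mixed]).

    The points [sigma p q (1 / 2)] and [sigma q p (1 / 2)] lie on one vertical
    line, and [mid p q] is their linear midpoint.  The conical inequality for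
    [sigma] and convexity of the norm make [mid] depend on [(p, q)] in a
    conical way ([mid_conical]); concatenating [sigma] from [p] to the midpoint
    and from there to [q] then keeps that inequality and the speed.  The
    midpoint property holds because [mid] is symmetric.  Reversibility fails
    because each half of [tau] is a path of [sigma], and from the tip of the
    antenna to [(- 1 / 2, 0)] [sigma] passes above the horizontal axis, but on
    the way back below it ([tau_not_reversible]). *)

(** * Bicombings in a metric space *)

Section MetricBicombings.
Context {R : realType} {M : metricType R}.
Implicit Types (X : set M) (sigma : M -> M -> R -> M).

(** A path of speed at most [mdist p q] that joins [p] to [q] in unit time has
    no slack: by the triangle inequality, losing length on [[s, t]] would make
    the whole path shorter than the distance of its ends. *)
Lemma bicombing_of_lipschitz X sigma :
  (forall p q t, X p -> X q -> t \in `[0, 1] -> X (sigma p q t)) ->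
  (forall p q, X p -> X q -> sigma p q 0 = p) ->
  (forall p q, X p -> X q -> sigma p q 1 = q) ->
  (forall p q s t, X p -> X q -> 0 <= s -> s <= t -> t <= 1 ->
     mdist (sigma p q s) (sigma p q t) <= (t - s) * mdist p q) ->
  bicombing X sigma.
Proof.
move=> sX s0 s1 lip; split => // p q.
have eqd s t : X p -> X q -> 0 <= s -> s <= t -> t <= 1 ->
    mdist (sigma p q s) (sigma p q t) = (t - s) * mdist p q.
  move=> Xp Xq hs st ht; apply/eqP; rewrite eq_le lip //=.
  have := metric_triangle p (sigma p q s) q.
  have := metric_triangle (sigma p q s) (sigma p q t) q.
  have := lip p q 0 s Xp Xq (lexx _) hs (le_trans st ht).
  have := lip p q t 1 Xp Xq (le_trans hs st) ht (lexx _).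
  by rewrite s0 // s1 //; lra.
move=> s t Xp Xq; rewrite !in_itv /= => /andP[hs hs1] /andP[ht ht1].
have [st|ts] := leP s t.
  by rewrite metric_sym eqd // ger0_norm // subr_ge0.
by rewrite eqd ?(ltW ts) // distrC ger0_norm // subr_ge0 ltW.
Qed.

End MetricBicombings.

Section Construction.
Context {R : realType}.
Implicit Types (p q : R * R) (t : R).

(** * The bicombing sigma *)

(** The expression is [y] clamped to [[- h, h]], that is
    [max (- h) (min y h)], which is 1-Lipschitz in [(y, h)]. *)
Lemma clamp_lip (y y' h h' : R) : 0 <= h -> 0 <= h' ->
  `|Num.sg y * Num.min `|y| h - Num.sg y' * Num.min `|y'| h'|
    <= Num.max `|y - y'| `|h - h'|.
Proof.
have clampE (z k : R) : 0 <= k ->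
    Num.sg z * Num.min `|z| k = Num.max (- k) (Num.min z k).
  move=> k0; case: (ltrgt0P z) => [z0|z0|->].
  - rewrite gtr0_sg // mul1r; case: (leP z) => ?; rewrite max_r //; lra.
  - rewrite ltr0_sg // mulN1r (min_l (_ : z <= k)); last lra.
    by case: (leP (- z)) => ?; [rewrite max_r|rewrite max_l] => //; lra.
  - by rewrite sgr0 mul0r min_l // max_r //; lra.
move=> h0 h0'; rewrite !clampE //.
have : `|y - y'| <= Num.max `|y - y'| `|h - h'| by rewrite le_max lexx.
have : `|h - h'| <= Num.max `|y - y'| `|h - h'| by rewrite le_max lexx orbT.
move: (Num.max `|_| _) => D; rewrite !ler_norml => /andP[? ?] /andP[? ?].
case: (leP y) => ?; case: (leP y') => ?;
  by case: (leP (- h)) => ?; case: (leP (- h')) => ?; apply/andP; split; lra.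
Qed.

Lemma pi_lip p q : mdist (pi p) (pi q) <= mdist p q.
Proof.
rewrite !mdist_max /= ge_max le_max lexx /=.
apply: le_trans (clamp_lip _ _ _ _) _ => //.
rewrite ge_max !le_max lexx orbT /=; apply/orP; left.
apply: le_trans (ler_dist_dist _ _) _.
by rewrite opprB addrA subrK ler_dist_dist.
Qed.

Lemma mdist_s p q : mdist (s p) (s q) = mdist p q.
Proof. by rewrite !mdist_max /= -opprD normrN. Qed.

(** Reflecting the antenna preserves its distance to the diamond, because this
    distance is horizontal: across [x = -1] the difference of the second
    coordinates never exceeds that of the first ones. *)
Lemma f_isom p q : X p -> X q -> mdist (f p) (f q) = mdist p q.
Proof.
have cross (p1 p2 q1 q2 e : R) :
    X (p1, p2) -> X (q1, q2) -> -1 <= p1 -> q1 < -1 ->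
    e = q2 \/ e = - q2 -> Num.max `|p1 - q1| `|p2 - e| = p1 - q1.
  move=> /XE[_ ? ? +] /XE[_ _ _ +] hp hq he; rewrite hp (lt_geF hq).
  move=> [? ?] ?; rewrite ger0_norm; last lra.
  by apply/max_l; rewrite ler_norml; lra.
case: p q => [p1 p2] [q1 q2] Xp Xq.
have [/andP[l1 l2] _ _ _] := (XE _ _).1 Xp.
have [/andP[l3 l4] _ _ _] := (XE _ _).1 Xq.
rewrite !fE ?l1 ?l3 //; case: leP => hp; case: leP => hq //.
- have c := cross _ _ _ _ _ Xp Xq hp hq.
  by rewrite !mdist_max /= !c; [|left|right].
- have c := cross _ _ _ _ _ Xq Xp hq hp.
  rewrite metric_sym (metric_sym (p1, p2)) !mdist_max /=.
  by rewrite !c; [|left|right].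
- exact: (mdist_s (p1, p2) (q1, q2)).
Qed.

Lemma f_isom' p q : X' p -> X' q -> mdist (f p) (f q) = mdist p q.
Proof.
by move=> Xp Xq; have := f_isom (f_XX' Xp) (f_XX' Xq); rewrite !fK.
Qed.

Lemma lambda_conical p q p' q' t : 0 <= t -> t <= 1 ->
  mdist (lambda p q t) (lambda p' q' t)
    <= (1 - t) * mdist p p' + t * mdist q q'.
Proof.
move=> t0 t1.
have -> : mdist (lambda p q t) (lambda p' q' t) =
    `|(1 - t) *: (p - p') + t *: (q - q')|.
  rewrite /lambda !scalerBr; congr `|_|; rewrite opprD !addrA; congr (_ - _).
  by rewrite addrAC.
apply: le_trans (ler_normD _ _) _.
by rewrite !normrZ !ger0_norm // subr_ge0.
Qed.

Lemma lambda_lip p q t t' : mdist (lambda p q t) (lambda p q t')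
  = `|t' - t| * mdist p q.
Proof.
have -> : mdist p q = `|p - q| by [].
rewrite -normrZ; have -> : (t' - t) *: (p - q) = lambda p q t - lambda p q t'.
  by congr pair; rewrite /= /GRing.scale /=; lra.
by [].
Qed.


Lemma sigma_ltr p q t : p.1 <= q.1 -> sigma p q t = pi (lambda p q t).
Proof. by rewrite /sigma => ->. Qed.

Lemma sigma_rtl p q t : X p -> X q -> q.1 <= p.1 ->
  sigma p q t = f (pi (lambda (f p) (f q) t)).
Proof. by move=> Xp Xq qp; rewrite sigma_overlap // !f_invE. Qed.

Lemma chart_X' p q t : X p -> X q -> t \in `[0, 1] ->
  X' (pi (lambda (f p) (f q) t)).
Proof. by move=> ? ? ?; apply/pi_Y'X'/lambda_Y' => //; left; exact: f_X'X. Qed.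

Lemma sigma_lip p q t t' : X p -> X q -> t \in `[0, 1] -> t' \in `[0, 1] ->
  mdist (sigma p q t) (sigma p q t') <= `|t' - t| * mdist p q.
Proof.
move=> Xp Xq t01 t01'; have [pq|/ltW qp] := leP p.1 q.1.
  rewrite !sigma_ltr //; apply: le_trans (pi_lip _ _) _.
  by rewrite lambda_lip.
rewrite !sigma_rtl // f_isom'; try exact: chart_X'.
by apply: le_trans (pi_lip _ _) _; rewrite lambda_lip f_isom.
Qed.

Lemma sigma_conical_ltr p q p' q' t : p.1 <= q.1 -> p'.1 <= q'.1 ->
  t \in `[0, 1] ->
  mdist (sigma p q t) (sigma p' q' t) <= (1 - t) * mdist p p' + t * mdist q q'.
Proof.
move=> pq pq'; rewrite in_itv /= => /andP[t0 t1]; rewrite !sigma_ltr //.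
exact: le_trans (pi_lip _ _) (lambda_conical _ _ _ _ t0 t1).
Qed.

Lemma sigma_conical_rtl p q p' q' t : X p -> X q -> X p' -> X q' ->
  q.1 <= p.1 -> q'.1 <= p'.1 -> t \in `[0, 1] ->
  mdist (sigma p q t) (sigma p' q' t) <= (1 - t) * mdist p p' + t * mdist q q'.
Proof.
move=> Xp Xq Xp' Xq' qp qp' t01; rewrite !sigma_rtl //.
rewrite f_isom'; try exact: chart_X'.
rewrite -(f_isom Xp Xp') -(f_isom Xq Xq').
move: t01; rewrite in_itv /= => /andP[t0 t1].
exact: le_trans (pi_lip _ _) (lambda_conical _ _ _ _ t0 t1).
Qed.

(** The two bounds add up to [mdist p q]: [sigma p q r] lies between [p] and
    [q], so estimates along the two pieces can be summed without loss. *)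
Lemma sigma_cut p q r : X p -> X q -> r \in `[0, 1] ->
  mdist p (sigma p q r) <= r * mdist p q /\
  mdist (sigma p q r) q <= (1 - r) * mdist p q.
Proof.
move=> Xp Xq r01; have [r0 r1] : 0 <= r /\ r <= 1.
  by move: r01; rewrite in_itv /= => /andP.
have e0 : 0 \in `[0, 1 : R] by rewrite in_itv /= lexx ler01.
have e1 : 1 \in `[0, 1 : R] by rewrite in_itv /= lexx ler01.
have := sigma_lip Xp Xq e0 r01; have := sigma_lip Xp Xq r01 e1.
by rewrite sigma0 // sigma1 // subr0 !ger0_norm ?subr_ge0.
Qed.

(** If the two pairs have opposite horizontal orders, moving [(p, q)] to
    [(p', q')] along [sigma] itself makes the first coordinates, which are
    affine in the parameter, coincide at some parameter [r].  The pair reached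
    there belongs to both orders, and since it cuts the geodesics from [p] to
    [p'] and from [q] to [q'] the estimates of the two halves add up. *)
Lemma sigma_conical_mixed p q p' q' t : X p -> X q -> X p' -> X q' ->
  p.1 <= q.1 -> q'.1 <= p'.1 -> t \in `[0, 1] ->
  mdist (sigma p q t) (sigma p' q' t) <= (1 - t) * mdist p p' + t * mdist q q'.
Proof.
move=> Xp Xq Xp' Xq' pq qp' t01.
(* [r] is the zero of the affine function
   [(1 - r) * (q.1 - p.1) - r * (p'.1 - q'.1)]. *)
have [r r01 er] : exists2 r, r \in `[0, 1] &
    (sigma p p' r).1 = (sigma q q' r).1.
  have a0 : 0 <= q.1 - p.1 by rewrite subr_ge0.
  have b0 : 0 <= p'.1 - q'.1 by rewrite subr_ge0.
  have [s0|s0] := eqVneq ((q.1 - p.1) + (p'.1 - q'.1)) 0.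
    by exists 0; [rewrite in_itv /= lexx ler01|rewrite !sigma_fst //; lra].
  have sp : 0 < (q.1 - p.1) + (p'.1 - q'.1) by rewrite lt_def s0 addr_ge0.
  exists ((q.1 - p.1) / ((q.1 - p.1) + (p'.1 - q'.1))).
    by rewrite in_itv /= divr_ge0 ?(ltW sp) //= ler_pdivrMr // mul1r lerDl.
  by rewrite !sigma_fst //; field.
have Xpr := sigma_X Xp Xp' r01; have Xqr := sigma_X Xq Xq' r01.
have [p1 p2] := sigma_cut Xp Xp' r01; have [q1 q2] := sigma_cut Xq Xq' r01.
set pr := sigma p p' r in er Xpr p1 p2 *.
set qr := sigma q q' r in er Xqr q1 q2 *.
have c1 : mdist (sigma p q t) (sigma pr qr t)
    <= (1 - t) * mdist p pr + t * mdist q qr.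
  by apply: sigma_conical_ltr; rewrite ?er.
have c2 : mdist (sigma pr qr t) (sigma p' q' t)
    <= (1 - t) * mdist pr p' + t * mdist qr q'.
  by apply: sigma_conical_rtl; rewrite ?er.
apply: le_trans (metric_triangle _ (sigma pr qr t) _) _.
apply: le_trans (lerD c1 c2) _.
rewrite addrACA -!mulrDr; move: t01; rewrite in_itv /= => /andP[t0 t1].
by apply: lerD; apply: ler_wpM2l; rewrite ?subr_ge0 //; lra.
Qed.

Lemma sigma_conical : conical (@X R) sigma.
Proof.
move=> p q p' q' t Xp Xq Xp' Xq' t01.
have [pq|/ltW qp] := leP p.1 q.1; have [pq'|/ltW qp'] := leP p'.1 q'.1.
- exact: sigma_conical_ltr.
- exact: sigma_conical_mixed.
- rewrite metric_sym (metric_sym p) (metric_sym q).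
  exact: sigma_conical_mixed.
- exact: sigma_conical_rtl.
Qed.

(** * The midpoint construction *)

Lemma half_itv : 1 / 2 \in `[0, 1 : R].
Proof. by rewrite in_itv /=; lra. Qed.

Lemma midC p q : mid p q = mid q p.
Proof. by rewrite /mid addrC. Qed.

Lemma mid_lambda p q :
  mid p q = lambda (sigma p q (1 / 2)) (sigma q p (1 / 2)) (1 / 2).
Proof. by rewrite /lambda /mid scalerDr; congr (_ *: _ + _); lra. Qed.

(** The conical inequality at time [1 / 2] gives the same bound for both
    points averaged by [mid], since it is symmetric in the two ends. *)
Lemma mid_conical p q p' q' : X p -> X q -> X p' -> X q' ->
  mdist (mid p q) (mid p' q') <= (mdist p p' + mdist q q') / 2.
Proof.
move=> Xp Xq Xp' Xq'.
rewrite !mid_lambda; apply: le_trans (lambda_conical _ _ _ _ _ _) _; try lra.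
have := sigma_conical Xp Xq Xp' Xq' half_itv.
have := sigma_conical Xq Xp Xq' Xp' half_itv.
lra.
Qed.

Lemma lambdaxx p t : lambda p p t = p.
Proof. by rewrite /lambda -scalerDl subrK scale1r. Qed.

Lemma sigmaxx p t : X p -> t \in `[0, 1] -> sigma p p t = p.
Proof. by move=> Xp t01; rewrite sigma_ltr // lambdaxx pi_id. Qed.

Lemma mid_xx p : X p -> mid p p = p.
Proof. by move=> Xp; rewrite mid_lambda sigmaxx ?half_itv // lambdaxx. Qed.

(** This is [mid_conical] against the constant pair [(p, p)]. *)
Lemma dist_mid p q : X p -> X q -> mdist p (mid p q) <= mdist p q / 2.
Proof.
move=> Xp Xq; rewrite -{1}(mid_xx Xp).
by apply: le_trans (mid_conical _ _ _ _) _ => //; rewrite mdistxx add0r.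
Qed.

Lemma itv_fst t : 0 <= t -> t <= 1 / 2 -> 2 * t \in `[0, 1].
Proof. by move=> ? ?; rewrite in_itv /=; lra. Qed.

Lemma itv_snd t : 1 / 2 <= t -> t <= 1 -> 2 * t - 1 \in `[0, 1].
Proof. by move=> ? ?; rewrite in_itv /=; lra. Qed.

Lemma tau_fst p q t : t <= 1 / 2 -> tau p q t = sigma p (mid p q) (2 * t).
Proof. by rewrite /tau => ->. Qed.

Lemma tau_snd p q t : X p -> X q -> 1 / 2 <= t ->
  tau p q t = sigma (mid p q) q (2 * t - 1).
Proof.
move=> Xp Xq; rewrite le_eqVlt => /predU1P[<-|t2].
  by rewrite tau_fst // tau_overlap.
by rewrite /tau leNgt t2.
Qed.

Lemma tau_half p q : X p -> X q -> tau p q (1 / 2) = mid p q.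
Proof.
move=> Xp Xq; rewrite tau_fst // mul1r divff ?pnatr_eq0 //.
by rewrite sigma1 //; exact: mid_X.
Qed.

Lemma tau_X p q t : X p -> X q -> t \in `[0, 1] -> X (tau p q t).
Proof.
move=> Xp Xq; rewrite in_itv /= => /andP[t0 t1].
have Xm := mid_X Xp Xq; have [t2|/ltW t2] := leP t (1 / 2).
  by rewrite tau_fst //; apply: sigma_X => //; exact: itv_fst.
by rewrite tau_snd //; apply: sigma_X => //; exact: itv_snd.
Qed.

Lemma tau_lip p q t t' : X p -> X q -> 0 <= t -> t <= t' -> t' <= 1 ->
  mdist (tau p q t) (tau p q t') <= (t' - t) * mdist p q.
Proof.
move=> Xp Xq; have Xm := mid_X Xp Xq; have dm := dist_mid Xp Xq.
have dm' : mdist (mid p q) q <= mdist p q / 2.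
  by rewrite metric_sym midC (metric_sym p) dist_mid.
have lip1 u v : 0 <= u -> u <= v -> v <= 1 / 2 ->
    mdist (tau p q u) (tau p q v) <= (v - u) * mdist p q.
  move=> u0 uv v1; have u1 := le_trans uv v1; have v0 := le_trans u0 uv.
  rewrite !tau_fst //.
  have := sigma_lip Xp Xm (itv_fst u0 u1) (itv_fst v0 v1).
  by rewrite ger0_norm; [nra|lra].
have lip2 u v : 1 / 2 <= u -> u <= v -> v <= 1 ->
    mdist (tau p q u) (tau p q v) <= (v - u) * mdist p q.
  move=> u0 uv v1; have u1 := le_trans uv v1; have v0 := le_trans u0 uv.
  rewrite !tau_snd //.
  have := sigma_lip Xm Xq (itv_snd u0 u1) (itv_snd v0 v1).
  by rewrite ger0_norm; [nra|lra].
move=> t0 tt' t1; have [h|/ltW h] := leP t' (1 / 2); first exact: lip1.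
have [h'|/ltW h'] := leP t (1 / 2); last exact: lip2.
apply: le_trans (metric_triangle _ (tau p q (1 / 2)) _) _.
apply: le_trans (lerD (lip1 _ _ t0 h' (lexx _)) (lip2 _ _ (lexx _) h t1)) _.
by rewrite -mulrDl ler_wpM2r ?mdist_ge0 //; lra.
Qed.

Lemma tau_bicombing : bicombing (@X R) tau.
Proof.
apply: bicombing_of_lipschitz; [exact: tau_X| | |by move=> *; exact: tau_lip].
- move=> p q Xp Xq; rewrite tau_fst ?mulr0; last lra.
  by rewrite sigma0 //; exact: mid_X.
- move=> p q Xp Xq; rewrite tau_snd //; last lra.
  by rewrite mulr1 (_ : 2 - 1 = 1) ?sigma1 //; [exact: mid_X|lra].
Qed.

Lemma tau_conical : conical (@X R) tau.
Proof.
move=> p q p' q' t Xp Xq Xp' Xq'; rewrite in_itv /= => /andP[t0 t1].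
have Xm := mid_X Xp Xq; have Xm' := mid_X Xp' Xq'.
have mm := mid_conical Xp Xq Xp' Xq'.
have [t2|/ltW t2] := leP t (1 / 2).
  rewrite !tau_fst //; have := sigma_conical Xp Xm Xp' Xm' (itv_fst t0 t2).
  nra.
rewrite !tau_snd //; have := sigma_conical Xm Xq Xm' Xq' (itv_snd t2 t1).
nra.
Qed.

Lemma tau_midpoint : midpoint_property (@X R) tau.
Proof. by move=> p q Xp Xq; rewrite !tau_half // midC. Qed.

(** * Failure of reversibility *)

(** For [p] the tip [(-2, 1)] of the antenna and [q = (1, 0)], the midpoint is
    [(- 1 / 2, 0)].  Going right, the segment to it is traced in [X], where the
    antenna is above the axis; going left it is traced in [X'], where the
    antenna is below.  At [t = 5 / 12] both segments are already inside the
    diamond, where [pi] and [f] are the identity, so the two points differ: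
    [(- 3 / 4, 1 / 6)] and [(- 3 / 4, - 1 / 6)]. *)
Lemma tau_not_reversible : ~ reversible (@X R) tau.
Proof.
have Xp : X (-2, 1 : R) by apply/XE; rewrite ifF; [split; lra|lra].
have Xq : X (1, 0 : R) by apply/XE; case: ifPn => ?; split; lra.
have fd (x y : R) : -1 <= x <= 1 -> f (x, y) = (x, y).
  by move=> /andP[x1 ?]; rewrite fE ?x1 //; lra.
have pid (x y : R) : -1 <= x -> x <= 0 -> - (1 + x) <= y -> y <= 1 + x ->
    pi (x, y) = (x, y).
  by move=> x1 ? ? ?; apply/pi_id/XE; rewrite x1; split; lra.
have fp : f (-2, 1 : R) = (-2, -1) by rewrite fE; [rewrite ifF //; lra|lra].
have me : mid (-2, 1) (1, 0) = (- (1 / 2), 0 : R).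
  rewrite /mid sigma_ltr ?sigma_rtl //=; [|lra..].
  rewrite fp fd; last lra.
  have -> : lambda (-2, 1) (1, 0) (1 / 2) = (- (1 / 2), 1 / 2 : R).
    by congr pair; rewrite /= /GRing.scale /=; lra.
  have -> : lambda (1, 0) (-2, -1) (1 / 2) = (- (1 / 2), - (1 / 2) : R).
    by congr pair; rewrite /= /GRing.scale /=; lra.
  rewrite !pid ?fd; [|lra..].
  by congr pair; rewrite /= /GRing.scale /=; lra.
have Xm := mid_X Xp Xq.
have t01 : 5 / 12 \in `[0, 1 : R] by rewrite in_itv /=; lra.
move=> /(_ (-2, 1) (1, 0) (5 / 12) Xp Xq t01).
rewrite tau_fst ?tau_snd //; [|lra..].
rewrite (midC (1, 0)); move: Xm; rewrite me => Xm.
rewrite sigma_ltr ?sigma_rtl //=; [|lra..].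
rewrite fp fd; last lra.
have -> : lambda (-2, 1) (- (1 / 2), 0) (2 * (5 / 12)) = (- (3 / 4), 1 / 6 : R).
  by congr pair; rewrite /= /GRing.scale /=; lra.
have -> : lambda (- (1 / 2), 0) (-2, -1) (2 * (1 - 5 / 12) - 1) =
    (- (3 / 4), - (1 / 6) : R).
  by congr pair; rewrite /= /GRing.scale /=; lra.
by rewrite !pid ?fd; [case; lra|lra..].
Qed.

End Construction.

Theorem lemma3p2 (R : realType) :
  [/\ bicombing (@X R) tau,
      conical (@X R) tau,
      ~ reversible (@X R) tau &
      midpoint_property (@X R) tau].
Proof.
split; [exact: tau_bicombing|exact: tau_conical|exact: tau_not_reversible|].
exact: tau_midpoint.
Qed.
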